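(* Let $E$ be a truncated normed Riesz space (with norm $\|\cdot\|$) with no truncation unit. Then the function that takes each $x+\alpha\in E\oplus\mathbb{R}$ to the positive real number $$\|x+\alpha\|_{0}=\sup\left\{\|y\|: y\in E\text{ and }|y|\leq|x+\alpha|\right\}$$ is the smallest unitization norm on $E\oplus\mathbb{R}$; that is, $\|\cdot\|_0$ is a unitization norm on $E\oplus\mathbb{R}$, and every unitization norm $\|\cdot\|_u$ on $E\oplus\mathbb{R}$ satisfies $\|x+\alpha\|_0\leq\|x+\alpha\|_u$ for all $x\in E$ and $\alpha\in\mathbb{R}$.
   Context: All Riesz spaces are real; ''positive'' means $\geq 0$. A truncated Riesz space is a nonzero Riesz space $E$ together with a truncation, i.e. a nonzero map $x\mapsto x^{*}$ from the positive cone $E^{+}$ into itself such that $x\wedge y^{*}\leq x^{*}\leq x$ for all $x,y\in E^{+}$. A truncation unit is an element $e>0$ of $E$ such that $x^{*}=e\wedge x$ for all $x\in E^{+}$. Unitization: the vector space direct sum $E\oplus\mathbb{R}$ (elements written $x+\alpha$ with $x\in E$, $\alpha\in\mathbb{R}$; $1$ denotes $0+1$; $x\in E$ is identified with $x+0$) is a Riesz space whose absolute value is given by $|x+0|=|x|$ and, for $\alpha\neq 0$, $|x+\alpha|=|x|-2|\alpha|\left(\tfrac{1}{\alpha}x^{-}\vee\tfrac{-1}{\alpha}x^{+}\right)^{*}+|\alpha|$. Equivalently, $x+\alpha\geq 0$ if and only if either $\alpha=0$ and $x\geq 0$, or $\alpha>0$ and $\left(\tfrac1\alpha x^{-}\right)^{*}=\tfrac1\alpha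 x^{-}$. For this structure (known from earlier work) $E$ is a Riesz subspace of $E\oplus\mathbb{R}$ and $x^{*}=1\wedge x$ for all $x\in E^{+}$. A lattice norm on a Riesz space is a norm such that $|u|\leq|v|$ implies $\|u\|\leq\|v\|$. A truncated normed Riesz space is a truncated Riesz space $E$ with a lattice norm $\|\cdot\|$ for which the truncation is norm-bounded; as a standing normalization, $\sup\{\|x^{*}\|:x\in E^{+}\}=1$. A unitization norm on $E\oplus\mathbb{R}$ is a lattice norm $\|\cdot\|_u$ on $E\oplus\mathbb{R}$ extending $\|\cdot\|$ (i.e. $\|x\|_u=\|x\|$ for $x\in E$) with $\|1\|_u=1$. *)

(* Defs.v *)
From HB Require Import structures.
From mathcomp Require Import all_boot all_order all_algebra.
From mathcomp Require Import boolp classical_sets reals.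

Set Implicit Arguments.
Unset Strict Implicit.
Unset Printing Implicit Defensive.

Import Order.TTheory GRing.Theory Num.Theory.
Local Open Scope ring_scope.

(** * Riesz spaces *)

(* Hierarchy-Builder refuses a structure joining [Order.Lattice] with
   [GRing.Lmodule], since [Num.RealDomain] already inherits from [Order.Lattice]
   and [GRing.Zmodule] with no intermediate join; the lattice operations are
   therefore fields of the mixin. *)
HB.mixin Record isRiesz (R : realType) E
    of GRing.Lmodule R E & Num.POrderedZmodule E := {
  rjoin : E -> E -> E;
  rmeet : E -> E -> E;
  rleUx : forall x y z : E, (rjoin x y <= z) = (x <= z) && (y <= z);
  rlexI : forall x y z : E, (z <= rmeet x y) = (z <= x) && (z <= y);
  riesz_leD2r : forall z x y : E, x <= y -> x + z <= y + z;
  riesz_leZ2l : forall (a : R) (x y : E), 0 <= a -> x <= y -> a *: x <= a *: y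
}.

#[short(type="rieszType")]
HB.structure Definition Riesz (R : realType) :=
  { E of isRiesz R E & GRing.Lmodule R E & Num.POrderedZmodule E }.

Reserved Notation "x \vee y" (at level 50, left associativity).
Reserved Notation "x \wedge y" (at level 48, left associativity).
Notation "x \vee y" := (rjoin x y) : ring_scope.
Notation "x \wedge y" := (rmeet x y) : ring_scope.

Section RieszOps.
Context {R : realType} {E : rieszType R}.
Implicit Types x : E.

Definition rpos x : E := (x \vee 0).
Definition rneg x : E := ((- x) \vee 0).
Definition rabs x : E := (x \vee - x).
End RieszOps.

Section RieszTheory.
Context {R : realType} {E : rieszType R}.
Implicit Types (x y z e : E) (a b : R).

Lemma rleUl x y : x <= x \vee y.
Proof. by have := rleUx x y (x \vee y); rewrite lexx => /esym/andP[]. Qed.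

Lemma rleUr x y : y <= x \vee y.
Proof. by have := rleUx x y (x \vee y); rewrite lexx => /esym/andP[]. Qed.

Lemma rleIl x y : x \wedge y <= x.
Proof. by have := rlexI x y (x \wedge y); rewrite lexx => /esym/andP[]. Qed.

Lemma rleIr x y : x \wedge y <= y.
Proof. by have := rlexI x y (x \wedge y); rewrite lexx => /esym/andP[]. Qed.

Lemma riesz_le_eq x y : (forall z, (x <= z) = (y <= z)) -> x = y.
Proof. by move=> h; apply/le_anti; rewrite h lexx -h lexx. Qed.

Lemma riesz_ge_eq x y : (forall z, (z <= x) = (z <= y)) -> x = y.
Proof. by move=> h; apply/le_anti; rewrite -h lexx h lexx. Qed.

Lemma rjoinC x y : x \vee y = y \vee x.
Proof. by apply: riesz_le_eq => z; rewrite !rleUx andbC. Qed.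

Lemma rmeetC x y : x \wedge y = y \wedge x.
Proof. by apply: riesz_ge_eq => z; rewrite !rlexI andbC. Qed.

Lemma rjoin_l x y : y <= x -> x \vee y = x.
Proof. by move=> h; apply/le_anti; rewrite rleUx lexx h rleUl. Qed.

Lemma rjoin_r x y : x <= y -> x \vee y = y.
Proof. by rewrite rjoinC; exact: rjoin_l. Qed.

Lemma rmeet_l x y : x <= y -> x \wedge y = x.
Proof. by move=> h; apply/le_anti; rewrite rlexI lexx h rleIl. Qed.

Lemma rle_scale a x y : 0 <= a -> x <= y -> a *: x <= a *: y.
Proof. exact: riesz_leZ2l. Qed.

Lemma rle_add2r z x y : (x + z <= y + z) = (x <= y).
Proof.
apply/idP/idP; last exact: riesz_leD2r.
by move=> /(@riesz_leD2r _ _ (- z)); rewrite !addrK.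
Qed.

Lemma rle_add2l z x y : (z + x <= z + y) = (x <= y).
Proof. by rewrite ![z + _]addrC rle_add2r. Qed.

Lemma rle_add x y z t : x <= y -> z <= t -> x + z <= y + t.
Proof.
move=> xy zt; apply: (@le_trans _ _ (y + z)); first by rewrite rle_add2r.
by rewrite rle_add2l.
Qed.

Lemma rsub_ge0 x y : (0 <= y - x) = (x <= y).
Proof. by rewrite -[LHS](rle_add2r x) add0r subrK. Qed.

Lemma rle_subl x y z : (x - y <= z) = (x <= z + y).
Proof. by rewrite -[LHS](rle_add2r y) subrK. Qed.

Lemma rle_opp2 x y : (- x <= - y) = (y <= x).
Proof. by rewrite -[LHS]rsub_ge0 opprK addrC rsub_ge0. Qed.

Lemma rle_pscale a x y : 0 < a -> (a *: x <= a *: y) = (x <= y).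
Proof.
move=> a0; apply/idP/idP; last exact/rle_scale/ltW.
have ai : 0 <= a^-1 by rewrite invr_ge0 ltW.
by move=> /(rle_scale ai); rewrite !scalerA mulVf ?gt_eqF// !scale1r.
Qed.

Lemma rscale_ge0 a x : 0 <= a -> 0 <= x -> 0 <= a *: x.
Proof. by move=> a0 /(rle_scale a0); rewrite scaler0. Qed.

Lemma rscale_le a b x : a <= b -> 0 <= x -> a *: x <= b *: x.
Proof.
by move=> ab x0; rewrite -rsub_ge0 -scalerBl rscale_ge0// subr_ge0.
Qed.

Lemma radd_join x y z : z + (x \vee y) = ((z + x) \vee (z + y)).
Proof.
apply: riesz_le_eq => t; rewrite rleUx.
by rewrite -[t](subrKC z) !rle_add2l rleUx.
Qed.

Lemma rscale_join a x y :
  0 <= a -> a *: (x \vee y) = ((a *: x) \vee (a *: y)).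
Proof.
rewrite le_eqVlt => /predU1P[<-|a0]; first by rewrite !scale0r rjoin_l.
apply: riesz_le_eq => t; rewrite rleUx.
have -> : t = a *: (a^-1 *: t) by rewrite scalerA mulfV ?gt_eqF// scale1r.
by rewrite !rle_pscale// rleUx.
Qed.

Lemma ropp_meet x y : - (x \wedge y) = ((- x) \vee (- y)).
Proof.
apply: riesz_le_eq => t; rewrite rleUx.
by rewrite -[t]opprK !rle_opp2 rlexI.
Qed.

Lemma ropp_join x y : - (x \vee y) = ((- x) \wedge (- y)).
Proof. by rewrite -[RHS]opprK ropp_meet !opprK. Qed.

Lemma rscale_meet a x y :
  0 <= a -> a *: (x \wedge y) = (a *: x) \wedge (a *: y).
Proof.
move=> a0; apply: oppr_inj.
by rewrite -scalerN !ropp_meet rscale_join// !scalerN.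
Qed.

Lemma rpos_ge0 x : 0 <= rpos x. Proof. exact: rleUr. Qed.
Lemma rneg_ge0 x : 0 <= rneg x. Proof. exact: rleUr. Qed.

Lemma rnegN x : rneg (- x) = rpos x.
Proof. by rewrite /rneg /rpos opprK. Qed.

Lemma rposN x : rpos (- x) = rneg x. Proof. by []. Qed.

Lemma rabsN x : rabs (- x) = rabs x.
Proof. by rewrite /rabs opprK rjoinC. Qed.

Lemma rposBneg x : rpos x - rneg x = x.
Proof.
suff -> : rpos x = x + rneg x by rewrite addrK.
by rewrite /rneg radd_join subrr addr0 rjoinC.
Qed.

Lemma rabsE x : rabs x = x + 2 *: rneg x.
Proof.
rewrite /rneg rscale_join ?ler0n// radd_join scaler0 addr0 rjoinC /rabs.
by rewrite scaler_nat mulr2n addrA subrr sub0r rjoinC.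
Qed.

(* The inequality behind the formula for the absolute value of the
   unitization: there, [e] plays the role of the unit [1]. *)
Lemma rabsB_neg_meet x e a : 0 <= a -> 0 <= e ->
  rabs x - 2 *: (rneg x \wedge a *: e) = (x \vee (- x - (2 * a) *: e)).
Proof.
move=> a0 e0.
rewrite -scalerN ropp_meet rscale_join ?ler0n// radd_join.
rewrite {1}rabsE scalerN addrK scalerN scalerA.
apply: riesz_le_eq => t; rewrite !rleUx; case: (boolP (x <= t)) => //= xt.
rewrite /rabs !rle_subl rleUx.
suff -> : x <= t + (2 * a) *: e by [].
by rewrite -[x]addr0 rle_add// rscale_ge0// mulr_ge0.
Qed.

End RieszTheory.

(** * Truncated Riesz spaces *)

(* [trunc] is total, but it is constrained, and only ever used, on the positive
   cone. [trunc_neq0] forces [E] to be nonzero. *)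
HB.mixin Record isTruncated (R : realType) E of Riesz R E := {
  trunc : E -> E;
  trunc_ge0 : forall x : E, 0 <= x -> 0 <= trunc x;
  trunc_meet : forall x y : E, 0 <= x -> 0 <= y ->
    rmeet x (trunc y) <= trunc x;
  trunc_le : forall x : E, 0 <= x -> trunc x <= x;
  trunc_neq0 : exists2 x : E, 0 <= x & trunc x != 0
}.

#[short(type="truncRieszType")]
HB.structure Definition TruncRiesz (R : realType) :=
  { E of isTruncated R E & Riesz R E }.

Arguments trunc_ge0 {R s} [x].
Arguments trunc_meet {R s} [x y].
Arguments trunc_le {R s} [x].

Definition truncation_unit {R : realType} {E : truncRieszType R} (e : E) :=
  0 < e /\ forall x : E, 0 <= x -> trunc x = e \wedge x.

Section TruncTheory.
Context {R : realType} {E : truncRieszType R}.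
Implicit Types (x y z e m : E) (a b : R).

Lemma trunc0 : trunc (0 : E) = 0.
Proof. by apply/le_anti; rewrite trunc_le// trunc_ge0. Qed.

Lemma truncK_le x y : 0 <= y -> y <= x -> trunc x = x -> trunc y = y.
Proof.
move=> y0 yx xx; have x0 := le_trans y0 yx.
apply/le_anti; rewrite trunc_le//=.
by have := trunc_meet y0 x0; rewrite xx rmeet_l.
Qed.

Lemma trunc_idem x : 0 <= x -> trunc (trunc x) = trunc x.
Proof.
move=> x0; apply/le_anti; rewrite trunc_le ?trunc_ge0//=.
by have := trunc_meet (trunc_ge0 x0) x0; rewrite rmeet_l.
Qed.

Lemma truncE m x : 0 <= x -> x <= m -> trunc x = x \wedge trunc m.
Proof.
move=> x0 xm; have m0 := le_trans x0 xm.
apply/le_anti; rewrite trunc_meet// andbT rlexI trunc_le//=.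
apply: le_trans (trunc_meet m0 x0).
by rewrite rlexI lexx andbT; apply: le_trans xm; exact: trunc_le.
Qed.

End TruncTheory.

(** * Unitization *)

(* The pair [(x, a)] stands for x + a. *)
Definition unitization {R : realType} (E : truncRieszType R) : Type :=
  (E * R^o)%type.

HB.instance Definition _ (R : realType) (E : truncRieszType R) :=
  GRing.Lmodule.copy (unitization E) (E * R^o)%type.

Section Unitization.
Context {R : realType} {E : truncRieszType R}.
Notation U := (unitization E).
Implicit Types (u v w : U) (x y e m : E) (a b : R).

Definition uadd (x : E) (a : R) : U := (x, a).
Definition uone : U := uadd 0 1.

Definition uge0 u : bool :=
  (u.2 == 0) && (0 <= u.1) ||
  (0 < u.2) && (trunc (u.2^-1 *: rneg u.1) == u.2^-1 *: rneg u.1).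

Definition uabs u : U :=
  if u.2 == 0 then uadd (rabs u.1) 0 else
  uadd (rabs u.1 - (2 * `|u.2|) *:
          trunc ((u.2^-1 *: rneg u.1) \vee ((- u.2^-1) *: rpos u.1)))
       `|u.2|.

Definition ule : rel U := fun u v => uge0 (v - u).
Definition ujoin u v : U := 2^-1 *: (u + v + uabs (u - v)).
Definition umeet u v : U := 2^-1 *: (u + v - uabs (u - v)).

Lemma unit_bound (s : seq E) : exists m, 0 <= m /\ {in s, forall x, x <= m}.
Proof.
elim: s => [|x s [m [m0 ms]]]; first by exists 0.
exists (x \vee m); split; first exact: le_trans (rleUr _ _).
move=> y; rewrite in_cons => /predU1P[->|/ms ym]; first exact: rleUl.
exact: le_trans (rleUr _ _).
Qed.

(* On finitely many elements, a common e can be substituted for the unit. *)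
Lemma unit_subst (s : seq U) (t : seq E) : exists e, [/\ 0 <= e,
  {in s, forall u, uge0 u = (0 <= u.2) && (- u.1 <= u.2 *: e)} &
  {in t, forall x, 0 <= x -> trunc x = x \wedge e}].
Proof.
have [m [m0 ms]] := unit_bound (t ++ [seq u.2^-1 *: rneg u.1 | u <- s]).
exists (trunc m); split; first exact: trunc_ge0.
- move=> u us; have um : u.2^-1 *: rneg u.1 <= m.
    apply: ms; rewrite mem_cat; apply/orP; right.
    by apply/mapP; exists u.
  rewrite /uge0; case: (ltgtP 0 u.2) => [u0|//|<-] /=; last first.
    by rewrite scale0r -[RHS]rle_opp2 opprK oppr0 orbF.

  have i0 : 0 < u.2^-1 by rewrite invr_gt0.
  have p0 : 0 <= u.2^-1 *: rneg u.1 by rewrite rscale_ge0 ?rneg_ge0// ltW.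
  have -> : (- u.1 <= u.2 *: trunc m) = (u.2^-1 *: rneg u.1 <= trunc m).
    rewrite -[RHS](rle_pscale _ _ u0) scalerA mulfV ?gt_eqF// scale1r rleUx.
    by rewrite (rscale_ge0 (ltW u0) (trunc_ge0 m0)) andbT.
  apply/eqP/idP => [pp|pm]; first by rewrite -pp (truncE p0 um) rleIr.
  exact: truncK_le pm (trunc_idem m0).
- by move=> x xt x0; rewrite (@truncE _ _ m)// ms// mem_cat xt.
Qed.

Lemma uge0D u v : uge0 u -> uge0 v -> uge0 (u + v).
Proof.
have [e [e0 he _]] := unit_subst [:: u; v; u + v] [::].
rewrite !he ?inE ?eqxx ?orbT// => /andP[u0 ue] /andP[v0 ve].
by rewrite addr_ge0//= opprD scalerDl rle_add.
Qed.

Lemma uge0Z a u : 0 <= a -> uge0 u -> uge0 (a *: u).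
Proof.
move=> a0; have [e [e0 he _]] := unit_subst [:: u; a *: u] [::].
rewrite !he ?inE ?eqxx ?orbT// => /andP[u0 ue].
by rewrite mulr_ge0//= -scalerN -scalerA rle_scale.
Qed.

Fact ule_refl : reflexive ule.
Proof. by move=> u; rewrite /ule subrr /uge0 /= eqxx lexx. Qed.

Fact ule_anti : antisymmetric ule.
Proof.
move=> u v /andP[]; rewrite /ule -[u - v]opprB => uv vu.
apply/esym/subr0_eq; move: uv vu; move: (v - u) => {u v} [x a].
rewrite /uge0 /= oppr_eq0 oppr_gt0.
case: (ltgtP 0 a) => // <- /=; rewrite !orbF => x0.
by rewrite -rle_opp2 opprK oppr0 => x1; congr (_, _); apply/le_anti/andP.
Qed.

Fact ule_trans : transitive ule.
Proof.
by move=> v u w uv vw; rewrite /ule -[w - u](subrKA v) uge0D.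
Qed.

HB.instance Definition _ :=
  Order.Le_isPOrder.Build ring_display U ule_refl ule_anti ule_trans.

Lemma uleE u v : (u <= v) = uge0 (v - u). Proof. by []. Qed.

Lemma uabsN u : uabs (- u) = uabs u.
Proof.
rewrite /uabs /= oppr_eq0 rabsN normrN rnegN rposN invrN opprK.
by rewrite rjoinC.
Qed.

Lemma uabs_le u w : (uabs u <= w) = (u <= w) && (- u <= w).
Proof.
wlog : u / 0 <= u.2 => [hw|].
  have [/hw//|u0] := leP 0 u.2.
  have nu0 : 0 <= (- u).2 by rewrite oppr_ge0 ltW.
  by rewrite -uabsN (hw _ nu0) opprK andbC.
move=> u0; rewrite !uleE opprK.
pose p := (u.2^-1 *: rneg u.1) \vee ((- u.2^-1) *: rpos u.1).
have [e [e0 he te]] := unit_subst [:: w - uabs u; w - u; w + u] [:: p].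
rewrite !he ?inE ?eqxx ?orbT// => {he}.
have -> : uabs u = uadd (u.1 \vee (- u.1 - (2 * u.2) *: e)) u.2.
  rewrite -rabsB_neg_meet// /uabs (ger0_norm u0).
  have [->|un0] := eqVneq u.2 0.
    by rewrite scale0r rmeetC rmeet_l ?rneg_ge0// scaler0 subr0.
  have up : 0 < u.2 by rewrite lt_def un0.
  have pE : p = u.2^-1 *: rneg u.1.
    apply: rjoin_l; apply: (@le_trans _ _ 0).
      rewrite scaleNr -rle_opp2 opprK oppr0.
      by rewrite rscale_ge0 ?rpos_ge0// invr_ge0.
    by rewrite rscale_ge0 ?rneg_ge0// invr_ge0.
  rewrite -/p te ?inE//; last first.
    by rewrite pE rscale_ge0 ?rneg_ge0// invr_ge0.
  congr (uadd (_ - _) _); rewrite -scalerA pE; congr (_ *: _).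
  rewrite rscale_meet; last exact: ltW.
  by rewrite scalerA mulfV// scale1r.
case: w u u0 {p te} => [y b] [x a] /= a0.
rewrite !opprB !opprD -!andbA; case: (boolP (0 <= b - a)) => //= ba.
have -> /= : 0 <= b + a.
  by rewrite (le_trans ba)// lerD2l (le_trans _ a0)// oppr_le0.
rewrite rle_subl rleUx rle_subl rle_subl; congr (_ && _).
rewrite [- y - x]addrC rle_subl addrAC -scalerDl.
by rewrite mulrDl mul1r addrA subrK.
Qed.

Fact ule_addr w u v : u <= v -> u + w <= v + w.
Proof. by rewrite !uleE opprD addrACA subrr addr0. Qed.

Fact ule_scale a u v : 0 <= a -> u <= v -> a *: u <= a *: v.
Proof. by move=> a0; rewrite !uleE -scalerBr; exact: uge0Z. Qed.

Let ule_half u v : (2^-1 *: u <= v) = (u <= 2 *: v).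
Proof.
apply/idP/idP => [/(@ule_scale 2 _ _ (ler0n _ _))|].
  by rewrite scalerA mulfV ?pnatr_eq0// scale1r.
have h : 0 <= 2^-1 :> R by rewrite invr_ge0 ler0n.
by move=> /(ule_scale h); rewrite scalerA mulVf ?pnatr_eq0// scale1r.
Qed.

Let ule_2 u v : (2 *: u <= 2 *: v) = (u <= v).
Proof. by rewrite -ule_half scalerA mulVf ?pnatr_eq0// scale1r. Qed.

Let ule_moveD u v w : (u + v <= w) = (v <= w - u).
Proof. by rewrite !uleE opprD addrA. Qed.

Fact ule_joinx u v w : (ujoin u v <= w) = (u <= w) && (v <= w).
Proof.
rewrite ule_half ule_moveD uabs_le opprB -!ule_moveD.
have h2 (p q : U) : p + q + (p - q) = 2 *: p.
  by rewrite addrACA subrr addr0 scaler_nat mulr2n.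
by rewrite h2 [u + v]addrC h2 !ule_2.
Qed.

Let ule_opp u v : (- u <= - v) = (v <= u).
Proof. by rewrite !uleE opprK addrC. Qed.

Fact ule_xmeet u v w : (w <= umeet u v) = (w <= u) && (w <= v).
Proof.
have -> : umeet u v = - ujoin (- u) (- v).
  rewrite /umeet /ujoin -scalerN; congr (_ *: _).
  by rewrite -(opprD u (- v)) uabsN !opprD !opprK.
by rewrite -[w in LHS]opprK ule_opp ule_joinx !ule_opp.
Qed.

HB.instance Definition _ := isRiesz.Build R U
  ule_joinx ule_xmeet ule_addr ule_scale.

(* The conventions above agree with the ones that define the unitization. *)

Lemma rabs_unitization u : rabs u = uabs u.
Proof. by apply: riesz_le_eq => w; rewrite rleUx uabs_le. Qed.

Lemma uadd0_le x y : (uadd x 0 <= uadd y 0) = (x <= y).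
Proof. by rewrite uleE /uge0 /= subrr eqxx ltxx orbF/= rsub_ge0. Qed.

Lemma uadd0_join x y : uadd (x \vee y) 0 = uadd x 0 \vee uadd y 0.
Proof.
apply: riesz_le_eq => w; rewrite rleUx !uleE.
have [e [e0 he _]] := unit_subst
  [:: w - uadd (x \vee y) 0; w - uadd x 0; w - uadd y 0] [::].
rewrite !he ?inE ?eqxx ?orbT//= !opprB !rle_subl rleUx.
by case: (0 <= _).
Qed.

Lemma trunc_unitization x : 0 <= x -> uadd (trunc x) 0 = uone \wedge uadd x 0.
Proof.
move=> x0; apply: riesz_ge_eq => w; rewrite rlexI !uleE.
have [e [e0 he te]] := unit_subst
  [:: uadd (trunc x) 0 - w; uone - w; uadd x 0 - w] [:: x].
rewrite !he ?inE ?eqxx ?orbT//= !opprB {}te ?inE// sub0r subr0.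
case: (boolP (0 <= - w.2)) => [b0|]; last by rewrite andbF.
have -> : 0 <= 1 - w.2 by rewrite addr_ge0.
rewrite /= scalerDl scale1r !rle_subl [_ + (x \wedge e)]addrC.
rewrite -[LHS]rle_subl rlexI.
by rewrite andbC !rle_subl [x + _]addrC.
Qed.

End Unitization.

(** * Norms *)

Definition is_norm {R : realType} {V : lmodType R} (N : V -> R) :=
  [/\ forall x, N x = 0 -> x = 0,
      forall a x, N (a *: x) = `|a| * N x &
      forall x y, N (x + y) <= N x + N y].

Definition lattice_norm {R : realType} {V : rieszType R} (N : V -> R) :=
  is_norm N /\ forall u v : V, rabs u <= rabs v -> N u <= N v.

(* The norm of a truncated normed Riesz space; [has_sup] is needed because
   [sup] is 0 on sets that have no supremum. *)
Definition truncated_norm {R : realType} {E : truncRieszType R} (N : E -> R) :=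
  let S := [set N (trunc x) | x in [set x : E | 0 <= x]]%classic in
  [/\ lattice_norm N, has_sup S & sup S = 1].

Definition unitization_norm {R : realType} {E : truncRieszType R} (N : E -> R)
    (Nu : unitization E -> R) :=
  [/\ lattice_norm Nu, forall x : E, Nu (uadd x 0) = N x & Nu uone = 1].

Definition norm0_set {R : realType} {E : truncRieszType R} (N : E -> R)
    (u : unitization E) : set R :=
  [set N y | y in [set y : E | rabs (uadd y 0) <= rabs u]]%classic.

Definition norm0 {R : realType} {E : truncRieszType R} (N : E -> R)
    (u : unitization E) : R := sup (norm0_set N u).

(* Main.v *)
Require Import Defs.
From HB Require Import structures.
From mathcomp Require Import all_boot all_order all_algebra.
From mathcomp Require Import boolp classical_sets reals.

Set Implicit Arguments.
Unset Strict Implicit.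
Unset Printing Implicit Defensive.

Import Order.TTheory GRing.Theory Num.Theory.
Local Open Scope ring_scope.

(** Write U for the unitization and 1 for its unit. The supremum defining
    [norm0 N u] is controlled by two facts about the embedding of E into U.

    First, E is an ideal of U ([unitization_ideal]), and an element x >= 0 of E
    lying below a 1 has N x <= a ([norm_le_scale_one]): for a > 0 the element
    x / a lies below 1, hence is fixed by the truncation, whose values have norm
    at most 1. Since |x + a| <= |x| + |a| 1, the suprema are finite, with
    norm0 (x + a) <= N x + |a| ([norm0_ub]). The triangle inequality is the
    Riesz decomposition: if |y| <= |u| + |v| with y in E, then |y| splits into
    |y| /\ |u| and a remainder below |v|, and both parts stay in E because E is
    an ideal ([norm0D]).

    Second, E meets every nonzero order interval [0, w] of U nontrivially
    because there is no truncation unit. Suppose w = z + 1 >= 0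
    dominates no nonzero element of E^+. Then 1 = - z + w, where w contributes
    nothing below any element of E, so x^* = x /\ 1 = x /\ (- z) and - z is a
    truncation unit ([truncation_unit_of_empty_interval]). This gives
    definiteness of the norm.

    Minimality is immediate: a unitization norm Nu satisfies N y = Nu y <= Nu u
    whenever y in E has |y| <= |u|. *)

(** * Absolute values in Riesz spaces *)

Section RieszAbs.
Context {R : realType} {E : rieszType R}.
Implicit Types (x y z : E) (a : R).

Lemma rabs_le x y : (rabs x <= y) = (x <= y) && (- x <= y).
Proof. exact: rleUx. Qed.

Lemma rabs_ge0 x : 0 <= rabs x.
Proof.
rewrite -(@rle_pscale _ _ 2) ?ltr0n// scaler0 scaler_nat mulr2n -[0](subrr x).
by rewrite rle_add ?rleUl ?rleUr.
Qed.

Lemma rabs_ge0_id x : 0 <= x -> rabs x = x.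
Proof.
by move=> x0; rewrite [LHS]rjoin_l// (le_trans _ x0)// -rle_opp2 oppr0 opprK.
Qed.

Lemma rabs_id x : rabs (rabs x) = rabs x.
Proof. exact/rabs_ge0_id/rabs_ge0. Qed.

Lemma rabsD x y : rabs (x + y) <= rabs x + rabs y.
Proof. by rewrite rabs_le opprD !rle_add ?rleUl ?rleUr. Qed.

Lemma rabsZ a x : rabs (a *: x) = `|a| *: rabs x.
Proof.
wlog a0 : a / 0 <= a => [hw|].
  have [/hw//|a0] := leP 0 a.
  by rewrite -rabsN -scaleNr hw ?normrN// oppr_ge0 ltW.
by rewrite ger0_norm// /rabs rscale_join// scalerN.
Qed.

Lemma rabs_eq0 x : rabs x = 0 -> x = 0.
Proof.
move=> x0; have: rabs x <= 0 by rewrite x0.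
rewrite rabs_le => /andP[x1 x2]; apply/le_anti; rewrite x1/=.
by rewrite -rle_opp2 oppr0.
Qed.

Lemma rpos_le x y : (rpos x <= y) = (x <= y) && (0 <= y).
Proof. exact: rleUx. Qed.

Lemma rle_rpos x : x <= rpos x. Proof. exact: rleUl. Qed.

Lemma lattice_norm_abs (N : E -> R) x : lattice_norm N -> N (rabs x) = N x.
Proof.
by case=> _ mono; apply/le_anti; rewrite !mono// rabs_id.
Qed.

Lemma norm_zero (N : E -> R) : is_norm N -> N 0 = 0.
Proof. by case=> _ Z _; rewrite -(scale0r (0 : E)) Z normr0 mul0r. Qed.

Lemma lattice_norm_le (N : E -> R) x y :
  lattice_norm N -> 0 <= x -> x <= y -> N x <= N y.
Proof.
by case=> _ mono x0 xy; apply: mono; rewrite !rabs_ge0_id// (le_trans x0).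
Qed.

End RieszAbs.

(** * The embedding into the unitization *)

Section Embedding.
Context {R : realType} {E : truncRieszType R}.
Notation U := (unitization E).
Implicit Types (x y z : E) (a b : R) (u v w : U).

Lemma uaddD x y a b : uadd x a + uadd y b = uadd (x + y) (a + b) :> U.
Proof. by []. Qed.

Lemma uaddZ b x a : b *: uadd x a = uadd (b *: x) (b * a) :> U.
Proof. by []. Qed.

Lemma uadd0B x y : uadd (x - y) 0 = uadd x 0 - uadd y 0 :> U.
Proof. by rewrite -[RHS]/(uadd (x - y) (0 - 0)) subrr. Qed.

Lemma uadd_one x a : uadd x a = uadd x 0 + a *: uone :> U.
Proof. by rewrite /uone uaddZ uaddD scaler0 addr0 add0r mulr1. Qed.

Lemma rabs_uadd0 x : rabs (uadd x 0) = uadd (rabs x) 0.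
Proof. by rewrite rabs_unitization /uabs/= eqxx. Qed.

Lemma uadd0_ge0 x : (0 <= uadd x 0) = (0 <= x).
Proof. exact: uadd0_le. Qed.

Lemma uone_ge0 : 0 <= uone :> U.
Proof.
rewrite uleE subr0 /uge0 /= ltr01 invr1 scale1r.
by rewrite /rneg oppr0 rjoin_l// Defs.trunc0 eqxx orbT.
Qed.

Lemma ule_snd u v : u <= v -> u.2 <= v.2.
Proof.
rewrite uleE /uge0 -[_ <= v.2]subr_ge0 => /orP[/andP[/eqP h _]|/andP[h _]].
  by rewrite -[v.2 - u.2]/(v - u).2 h.
exact: ltW.
Qed.

(** The scalar part is monotone, so an element squeezed between two elements
    with scalar part 0 has scalar part 0. *)
Lemma unitization_ideal u x : 0 <= u -> u <= uadd x 0 -> u = uadd u.1 0.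
Proof.
case: u => [y b] /ule_snd/= b0 /ule_snd/= b1.
by congr (_, _); apply/le_anti; rewrite b1 b0.
Qed.

Lemma trunc_fix x : 0 <= x -> uadd x 0 <= uone -> trunc x = x.
Proof.
move=> x0 x1; have := trunc_unitization x0.
by rewrite rmeetC rmeet_l// => -[].
Qed.

Lemma trunc_le_uone x : 0 <= x -> uadd (trunc x) 0 <= uone.
Proof. by move=> x0; rewrite trunc_unitization// rleIl. Qed.

(** With w = z + 1 above no nonzero element of the positive cone of E, the
    element z^+, being below w, vanishes, so - z is positive; and any y in E
    below 1 = - z + w satisfies (y + z)^+ <= w, hence y <= - z. *)
Lemma truncation_unit_of_empty_interval_one z :
  0 <= uadd z 1 -> (forall y, 0 <= y -> uadd y 0 <= uadd z 1 -> y = 0) ->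
  truncation_unit (- z).
Proof.
move=> w0 disj.
have zw : uadd z 0 <= uadd z 1.
  by rewrite [uadd z 1]uadd_one scale1r -[leLHS]addr0 rle_add2l uone_ge0.
have z_le0 : z <= 0.
  rewrite -(disj (rpos z)) ?rle_rpos ?rpos_ge0//.
  by rewrite /rpos uadd0_join rleUx zw.
have nz0 : 0 <= - z by rewrite -[0]oppr0 rle_opp2.
have below y : uadd y 0 <= uone -> y <= - z.
  move=> y1; have : rpos (y + z) <= 0.
    rewrite (disj (rpos (y + z))) ?rpos_ge0//.
    rewrite /rpos uadd0_join rleUx w0 andbT.
    have -> : uadd (y + z) 0 = uadd y 0 + uadd z 0 :> U.
      by rewrite uaddD addr0.
    by rewrite [uadd z 1]uadd_one scale1r [leRHS]addrC rle_add2r.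
  by rewrite rpos_le => /andP[+ _]; rewrite -[z in y + z]opprK rle_subl add0r.
have unitE x : 0 <= x -> trunc x = - z \wedge x.
  move=> x0; apply/le_anti; rewrite rlexI trunc_le// below ?trunc_le_uone//=.
  rewrite -uadd0_le trunc_unitization// rlexI !uadd0_le rleIr andbT.
  apply: le_trans (_ : uadd (- z) 0 <= _); first by rewrite uadd0_le rleIl.
  have <- : uadd (- z) 0 + uadd z 1 = uone :> U by rewrite uaddD addNr add0r.
  by rewrite -[leLHS]addr0 rle_add2l.
split=> //; rewrite lt_def nz0 andbT; apply/eqP => nz_eq0.
have [x x0 /eqP[]] := @trunc_neq0 R E.
by rewrite unitE// nz_eq0 rmeet_l.
Qed.

Lemma truncation_unit_of_empty_interval w :
  0 <= w -> 0 < w.2 -> (forall y, 0 <= y -> uadd y 0 <= w -> y = 0) ->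
  truncation_unit (- (w.2^-1 *: w.1)).
Proof.
case: w => [x a] /= w0 a0 disj; have an0 : a != 0 by rewrite gt_eqF.
have wE : uadd (a^-1 *: x) 1 = a^-1 *: uadd x a by rewrite uaddZ mulVf.
apply: truncation_unit_of_empty_interval_one.
  by rewrite wE rscale_ge0// invr_ge0 ltW.
move=> y y0; rewrite wE -(rle_pscale _ _ a0) scalerA mulfV// scale1r.
rewrite uaddZ mulr0 => yw.
have /eqP := disj _ (rscale_ge0 (ltW a0) y0) yw.
by rewrite scaler_eq0 (negPf an0)/= => /eqP.
Qed.

(** An element outside E has |u| with a nonzero scalar part, to which the
    previous lemma applies; an element of E lies in its own interval. *)
Lemma unitization_order_dense u : ~ (exists e : E, truncation_unit e) ->
  (forall y, 0 <= y -> uadd y 0 <= rabs u -> y = 0) -> u = 0.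
Proof.
move=> nounit disj; apply: rabs_eq0.
have a_ge0 : 0 <= (rabs u).2 := ule_snd (rabs_ge0 u).
move: a_ge0; rewrite le_eqVlt => /predU1P[a0|a0].
  have uE : rabs u = uadd (rabs u).1 0 by case: (rabs u) a0 => x a /= <-.
  have x0 : 0 <= (rabs u).1 by rewrite -[_ <= _]uadd0_ge0 -uE rabs_ge0.
  by rewrite uE (disj _ x0)// -uE.
case: nounit; exists (- ((rabs u).2^-1 *: (rabs u).1)).
exact: truncation_unit_of_empty_interval (rabs_ge0 u) a0 disj.
Qed.

End Embedding.

(** * The smallest unitization norm *)

Section Norm0.
Context {R : realType} {E : truncRieszType R} (N : E -> R).
Hypothesis hN : truncated_norm N.
Notation U := (unitization E).
Implicit Types (x y z : E) (a b : R) (u v w : U).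

Let latN : lattice_norm N. Proof. by case: hN. Qed.
Let normN : is_norm N. Proof. by case: latN. Qed.

Lemma norm_trunc_le1 x : 0 <= x -> N (trunc x) <= 1.
Proof.
case: hN => _ supS <- x0; apply: (ub_le_sup (proj2 supS)).
by exists x.
Qed.

Lemma norm_le_scale_one x a :
  0 <= x -> 0 <= a -> uadd x 0 <= a *: uone -> N x <= a.
Proof.
move=> x0; rewrite le_eqVlt => /predU1P[<-|a0].
  rewrite scale0r => x_le0; have x1 : x <= 0 by rewrite -[_ <= _]uadd0_le.
  by rewrite (_ : x = 0) ?norm_zero//; apply/le_anti/andP.
have an0 : a != 0 by rewrite gt_eqF.
have {1}-> : uadd x 0 = a *: uadd (a^-1 *: x) 0.
  by rewrite uaddZ scalerA mulfV// scale1r mulr0.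
rewrite rle_pscale// => xa1.
have xa0 : 0 <= a^-1 *: x by rewrite rscale_ge0// invr_ge0 ltW.
have := norm_trunc_le1 xa0; rewrite trunc_fix//.
case: normN => _ -> _; rewrite gtr0_norm ?invr_gt0//.
by rewrite ler_pdivrMl// mulr1.
Qed.

(** The part of |y| exceeding |x| lies in E and below |a| 1. *)
Lemma norm0_ub x a y :
  rabs (uadd y 0) <= rabs (uadd x a) -> N y <= N x + `|a|.
Proof.
move=> yxa; set p := rpos (rabs y - rabs x).
have p_le : uadd p 0 <= `|a| *: uone.
  rewrite /p /rpos uadd0_join rleUx rscale_ge0 ?uone_ge0 ?normr_ge0// andbT.
  rewrite uadd0B rle_subl [leRHS]addrC -!rabs_uadd0 (le_trans yxa)//.
  rewrite -[uone](rabs_ge0_id uone_ge0) -rabsZ.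
  by rewrite [uadd x a]uadd_one rabsD.
have Np : N p <= `|a| by apply: norm_le_scale_one; rewrite ?rpos_ge0.
rewrite -(lattice_norm_abs y latN) -(lattice_norm_abs x latN).
apply: (@le_trans _ _ (N (rabs x + p))).
  apply: lattice_norm_le; rewrite ?rabs_ge0//.
  by rewrite addrC -rle_subl rle_rpos.
by case: normN => _ _ D; rewrite (le_trans (D _ _))// lerD2l.
Qed.

Lemma norm0_has_sup u : has_sup (norm0_set N u).
Proof.
split; first by exists (N 0), 0 => //=; rewrite rabs_ge0_id ?uadd0_ge0// rabs_ge0.
case: u => x a; exists (N x + `|a|) => _ [y /= yxa <-].
exact: norm0_ub yxa.
Qed.

Lemma norm0_ge u y : rabs (uadd y 0) <= rabs u -> N y <= norm0 N u.
Proof.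
by move=> yu; apply: (ub_le_sup (proj2 (norm0_has_sup u))); exists y.
Qed.

Lemma norm0_le u a :
  (forall y, rabs (uadd y 0) <= rabs u -> N y <= a) -> norm0 N u <= a.
Proof.
move=> h; apply: ge_sup; first exact: (proj1 (norm0_has_sup u)).
by move=> _ [y /= yu <-]; exact: h.
Qed.

Lemma norm0_mono u v : rabs u <= rabs v -> norm0 N u <= norm0 N v.
Proof. by move=> uv; apply: norm0_le => y yu; rewrite norm0_ge// (le_trans yu). Qed.

Lemma norm0_extends x : norm0 N (uadd x 0) = N x.
Proof.
apply/le_anti; rewrite norm0_ge// andbT; apply: norm0_le => y.
by rewrite !rabs_uadd0 uadd0_le; case: latN => _; apply.
Qed.

(** The values of the truncation are the positive elements of E below 1, so both
    suprema run over the same norms. *)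
Lemma norm0_uone : norm0 N uone = 1.
Proof.
apply/le_anti/andP; split.
  apply: norm0_le => y /norm0_ub.
  by rewrite normr1 norm_zero// add0r.
case: hN => _ supS {1}<-; apply: ge_sup; first exact: (proj1 supS).
move=> _ [x /= x0 <-]; apply: norm0_ge.
by rewrite !rabs_ge0_id ?uone_ge0 ?uadd0_ge0 ?trunc_ge0// trunc_le_uone.
Qed.

(** For nonzero a, scaling by the inverse of a maps elements dominated by a u to
    elements dominated by u. *)
Lemma norm0Z_le a u : norm0 N (a *: u) <= `|a| * norm0 N u.
Proof.
have [->|a0] := eqVneq a 0.
  by rewrite scale0r normr0 mul0r (norm0_extends 0) norm_zero.
apply: norm0_le => y yau; have na0 : 0 < `|a| by rewrite normr_gt0.
rewrite -ler_pdivrMl// -normfV; case: normN => _ <- _.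
apply: norm0_ge; rewrite -[0](mulr0 a^-1) -uaddZ rabsZ normfV.
by rewrite -(rle_pscale _ _ na0) scalerA mulfV ?gt_eqF// scale1r -rabsZ.
Qed.

(** The reverse inequality is the previous one for the inverse scalar, when a
    is nonzero. *)
Lemma norm0Z a u : norm0 N (a *: u) = `|a| * norm0 N u.
Proof.
apply/le_anti; rewrite norm0Z_le/=; have [->|a0] := eqVneq a 0.
  by rewrite scale0r normr0 mul0r (norm0_extends 0) norm_zero.
rewrite -ler_pdivlMl ?normr_gt0// -normfV.
by rewrite -{1}[u](scale1r) -(mulVf a0) -scalerA norm0Z_le.
Qed.

(** Riesz decomposition of |y|, with both summands kept in E by the ideal
    property. *)
Lemma norm0D u v : norm0 N (u + v) <= norm0 N u + norm0 N v.
Proof.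
apply: norm0_le => y yuv.
set Y := uadd (rabs y) 0 : U; pose Y1 := Y \wedge rabs u.
have Y_ge0 : 0 <= Y by rewrite uadd0_ge0 rabs_ge0.
have Y1_ge0 : 0 <= Y1 by rewrite rlexI Y_ge0 rabs_ge0.
have Y1E : Y1 = uadd Y1.1 0 by apply: unitization_ideal Y1_ge0 (rleIl _ _).
have Y2E : Y - Y1 = uadd (rabs y - Y1.1) 0.
  by rewrite uadd0B -Y1E.
have Y2_ge0 : 0 <= Y - Y1 by rewrite rsub_ge0 rleIl.
(* Y - (Y /\ |u|) is the positive part of Y - |u|. *)
have Y2_le : Y - Y1 <= rabs v.
  rewrite ropp_meet radd_join subrr rleUx rabs_ge0/=.
  by rewrite rle_subl addrC /Y -rabs_uadd0 (le_trans yuv) ?rabsD.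
rewrite -(lattice_norm_abs y latN) -[rabs y](subrKC Y1.1).
case: normN => _ _ D; apply: le_trans (D _ _) _; apply: lerD; apply: norm0_ge.
  by rewrite -Y1E rabs_ge0_id// rleIr.
by rewrite -Y2E rabs_ge0_id.
Qed.

Lemma norm0_eq0 u :
  ~ (exists e : E, truncation_unit e) -> norm0 N u = 0 -> u = 0.
Proof.
move=> nounit u0; apply: unitization_order_dense => // y y0 yu.
have Ny : N y <= 0 by rewrite -u0 norm0_ge// rabs_ge0_id ?uadd0_ge0.
case: normN => N0 _ _; apply: N0; apply/le_anti; rewrite Ny/=.
by rewrite -(norm_zero normN) lattice_norm_le.
Qed.

Lemma norm0_min (Nu : U -> R) u : unitization_norm N Nu -> norm0 N u <= Nu u.
Proof.
by case=> -[_ mono] ext _; apply: norm0_le => y /mono; rewrite ext.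
Qed.

End Norm0.

Theorem theorem2p3 (R : realType) (E : truncRieszType R) (N : E -> R)
    (hN : truncated_norm N) (hE : ~ exists e : E, truncation_unit e) :
  (forall u : unitization E, has_sup (norm0_set N u)) /\
  unitization_norm N (norm0 N) /\
  forall Nu : unitization E -> R, unitization_norm N Nu ->
    forall (x : E) (a : R), norm0 N (uadd x a) <= Nu (uadd x a).
Proof.
split; first exact: norm0_has_sup.
split; last by move=> Nu hNu x a; exact: norm0_min.
split; [|exact: norm0_extends|exact: norm0_uone].
split; last exact: norm0_mono.
by split=> [u||]; [exact: norm0_eq0|exact: norm0Z|exact: norm0D].
Qed.
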